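(* Let $\sigma>0$, let $t>0$ with $t\neq2$, let $X$ be a random variable with the Maxwell distribution with scale parameter $\sigma$, and let $F_t$ denote the cumulative distribution function of $X^t$. Then $F_t\in D(\Lambda)$, where $\Lambda(x)=\exp\{-\exp(-x)\}$.
   Context: The Maxwell distribution with scale $\sigma>0$ is the distribution on $(0,\infty)$ with density $f(x)=\sqrt{2/\pi}\,\frac{x^2}{\sigma^3}\exp\left(-\frac{x^2}{2\sigma^2}\right)$, $x>0$. $D(\Lambda)$ denotes the max-domain of attraction of the Gumbel law $\Lambda$: a distribution function $G$ belongs to $D(\Lambda)$ if there are constants $\alpha_n>0$, $\beta_n\in\mathbb{R}$ with $\lim_{n\to\infty}G^n(\alpha_nx+\beta_n)=\Lambda(x)$ for all $x\in\mathbb{R}$. *)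

(* Defs.v *)
From HB Require Import structures.
From mathcomp Require Import all_boot all_order all_algebra.
From mathcomp Require Import all_classical all_reals all_analysis.
From mathcomp Require Import measurable_realfun.

Set Implicit Arguments.
Unset Strict Implicit.
Unset Printing Implicit Defensive.

Import Order.TTheory GRing.Theory Num.Theory.
Import numFieldNormedType.Exports.

Local Open Scope classical_set_scope.
Local Open Scope ring_scope.

Definition maxwell_pdf {R : realType} (sigma x : R) : R :=
  if 0 < x then
    Num.sqrt (2 / pi) * (x ^+ 2 / sigma ^+ 3)
    * expR (- (x ^+ 2 / (2 * sigma ^+ 2)))
  else 0.

Definition maxwell_prob {R : realType} (sigma : R) : set R -> \bar R :=
  fun V => (\int[lebesgue_measure]_(x in V) (maxwell_pdf sigma x)%:E)%E.

Definition has_maxwell_distribution {d : measure_display}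
    {T : measurableType d} {R : realType} {P : probability T R}
    (X : {RV P >-> R}) (sigma : R) : Prop :=
  forall A : set R, measurable A -> distribution P X A = maxwell_prob sigma A.

Section power.
Context {d : measure_display} {T : measurableType d} {R : realType}.
Variables (P : probability T R) (X : {RV P >-> R}) (t : R).

(* [powR] is total: it takes the value 1 at a negative base when [t != 0]. This
   is immaterial for a random variable which is positive almost surely. *)
Definition RVpow (w : T) : R := X w `^ t.

Let measurable_RVpow : measurable_fun [set: T] RVpow.
Proof. exact: (measurableT_comp (measurable_powR t)). Qed.

HB.instance Definition _ :=
  isMeasurableFun.Build _ _ _ _ RVpow measurable_RVpow.

End power.

(* The library's [cdf] is valued in [\bar R]; this is its real-valued version,
   a bounded cumulative function with limits 0 at -oo and 1 at +oo. *)
Section real_valued_cdf.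
Context {d : measure_display} {T : measurableType d} {R : realType}.
Variables (P : probability T R) (X : {RV P >-> R}).

Definition rcdf (x : R) : R := fine (cdf X x).

Let rcdf_nd : nondecreasing rcdf.
Proof.
by move=> *; rewrite /rcdf fine_le ?fin_num_measure// cdf_nondecreasing.
Qed.

Let rcdf_rc : right_continuous rcdf.
Proof.
move=> a; apply: fine_cvg.
by rewrite fineK ?fin_num_measure//; exact: cdf_right_continuous.
Qed.

HB.instance Definition _ := isCumulative.Build R _ R rcdf rcdf_nd rcdf_rc.

Let rcdf_Ny0 : rcdf @ -oo --> (0 : R).
Proof. exact/fine_cvg/cvg_cdfNy0. Qed.

Let rcdf_y1 : rcdf @ +oo --> (1 : R).
Proof. exact/fine_cvg/cvg_cdfy1. Qed.

HB.instance Definition _ :=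
  isCumulativeBounded.Build R 0 1 rcdf rcdf_Ny0 rcdf_y1.

End real_valued_cdf.

Definition gumbel_cdf {R : realType} (x : R) : R := expR (- expR (- x)).

Definition max_domain_of_attraction {R : realType} (H : R -> R) :
    set (cumulativeBounded (0 : R) (1 : R)) :=
  [set G | exists alpha beta : nat -> R,
     (forall n, 0 < alpha n) /\
     (forall x : R, G (alpha n * x + beta n) ^+ n @[n --> \oo] --> H x)].

(* Main.v *)
Require Import Defs.
From HB Require Import structures.
From mathcomp Require Import all_boot all_order all_algebra.
From mathcomp Require Import all_classical all_reals all_analysis.
From mathcomp Require Import measurable_realfun.
From mathcomp Require Import ring lra.

Set Implicit Arguments.
Unset Strict Implicit.
Unset Printing Implicit Defensive.

Import Order.TTheory GRing.Theory Num.Theory.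
Import numFieldNormedType.Exports.

Local Open Scope classical_set_scope.
Local Open Scope ring_scope.

(** Write S(z) for the probability that X exceeds z, f for the Maxwell density
and h(z) = sqrt(2/pi) (z/sigma) exp(-z^2/(2 sigma^2)) ([maxwell_tail]).

The tail S is equivalent to h at infinity. Indeed
-h'(x) = f(x) (1 - sigma^2/x^2) and h vanishes at infinity, so h(z) is the
integral of f(x) (1 - sigma^2/x^2) over x > z; on that range the extra factor
lies between 1 - sigma^2/z^2 and 1, which sandwiches h(z) between
(1 - sigma^2/z^2) S(z) and S(z) ([maxwell_ccdf_bounds]).

In the variable v = z^2/(2 sigma^2), h is a multiple of sqrt(v) exp(-v).
A sequence v_n, equivalent to ln n, is chosen such that n h(b_n) tends to 1 at
b_n = sigma sqrt(2 v_n) ([ex_norming_seq]).  The norming constants of the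
theorem are

  beta_n = b_n^t,    alpha_n = t b_n^t / (2 v_n) = t sigma^2 b_n^(t-2).

For fixed x, alpha_n x + beta_n = z_n^t with
z_n = b_n (1 + t x / (2 v_n))^(1/t), and in the variable v the point z_n is
w_n = v_n (1 + t x / (2 v_n))^(2/t).  Differentiating y^(2/t) at 1 gives
w_n - v_n --> x ([cvg_powR_slope]), while z_n / b_n --> 1; hence
h(z_n) / h(b_n) --> exp(-x), and n S(z_n) --> exp(-x) by the tail equivalence.
Since X^t > z^t exactly when X > z ([rcdf_RVpow]), the n-th power of the
distribution function of X^t at alpha_n x + beta_n is (1 - S(z_n))^n, whose
limit is exp(-exp(-x)) ([cvg_onemXn_expR]). *)

(** * Limits at infinity *)

(** The law of rare events: after taking logarithms,
-u/(1-u) <= ln (1-u) <= -u squeezes n ln (1 - u_n). *)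
Lemma cvg_onemXn_expR {R : realType} (u : nat -> R) (c : R) :
  n%:R * u n @[n --> \oo] --> c ->
  (1 - u n) ^+ n @[n --> \oo] --> expR (- c).
Proof.
move=> nuc.
have u0 : u n @[n --> \oo] --> 0.
  have : (n%:R^-1 * (n%:R * u n)) @[n --> \oo] --> 0 * c.
    apply: cvgM => //; apply/gtr0_cvgV0; last exact: cvgr_idn.
    by near=> n; rewrite ltr0n; near: n; exact: nbhs_infty_gt.
  rewrite mul0r; apply: cvg_trans; apply: near_eq_cvg; near=> n.
  by rewrite mulKf// pnatr_eq0 -lt0n; near: n; exact: nbhs_infty_gt.
have u1 : \forall n \near \oo, u n < 1 by exact: (cvgr_lt _ u0).
have : expR (n%:R * ln (1 - u n)) @[n --> \oo] --> expR (- c).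
  apply: (cvg_comp _ expR); last exact: continuous_expR.
  apply: (@squeeze_cvgr _ _ _ _ (fun n => - (n%:R * u n) / (1 - u n))
    (fun n => - (n%:R * u n))).
  - near=> n.
    have un1 : 0 < 1 - u n by rewrite subr_gt0; near: n.
    apply/andP; split.
      rewrite -mulrN -mulrA ler_wpM2l//.
      (* the lower bound is ln (1 + y) <= y at y = u / (1 - u),
         because 1 + y = 1 / (1 - u) *)
      rewrite -[1 - u n in leRHS]invrK lnV ?posrE ?invr_gt0//.
      rewrite mulNr lerN2.
      rewrite [X in ln X](_ : _ = 1 + u n / (1 - u n)); last first.
        by field; exact: lt0r_neq0.
      apply: le_ln1Dx.
      by rewrite ltr_pdivlMr//; lra.
    rewrite -mulrN ler_wpM2l//; apply: le_ln1Dx.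
    by rewrite ltrN2; near: n.
  - rewrite -[X in _ --> X]divr1 -[X in _ / X]subr0.
    apply: cvgM; first exact: cvgN.
    by apply: cvgV; [rewrite subr0 oner_neq0 | apply: cvgB => //; exact: cvg_cst].
  - exact: cvgN.
apply: cvg_trans; apply: near_eq_cvg; near=> n.
rewrite expRM_natl lnK// posrE subr_gt0; near: n; exact: u1.
Unshelve. all: by end_near. Qed.

Lemma cvg_lny {R : realType} : ln x @[x --> +oo] --> (+oo : set_system R).
Proof.
apply/cvgryPge => A; near=> x.
have x0 : 0 < x by near: x; apply: nbhs_pinfty_gt; exact: num_real.
rewrite -ler_expR lnK ?posrE//; near: x; apply: nbhs_pinfty_ge; exact: num_real.
Unshelve. all: by end_near. Qed.

Lemma cvg_sqrty {R : realType} :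
  Num.sqrt x @[x --> +oo] --> (+oo : set_system R).
Proof.
apply/cvgryPge => A; near=> x.
have [A0|/ltW A0] := leP 0 A; last exact: le_trans A0 (sqrtr_ge0 _).
rewrite -(ger0_norm A0) -sqrtr_sqr; apply: ler_wsqrtr.
by near: x; apply: nbhs_pinfty_ge; exact: num_real.
Unshelve. all: by end_near. Qed.

(** From ln (sqrt x) <= sqrt x, ln x / x is at most 2 / sqrt x. *)
Lemma cvg_ln_div {R : realType} : (ln x / x : R) @[x --> +oo] --> 0.
Proof.
apply: (@squeeze_cvgr _ _ _ _ (cst 0) (fun x : R => 2 * (Num.sqrt x)^-1)).
- near=> x.
  have x1 : 1 <= x by near: x; apply: nbhs_pinfty_ge; exact: num_real.
  have x0 : 0 < x by exact: lt_le_trans x1.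
  have s0 : 0 < Num.sqrt x by rewrite sqrtr_gt0.
  rewrite divr_ge0 ?ln_ge0 ?(ltW x0)//=.
  rewrite ler_pdivrMr// -{3}(sqr_sqrtr (ltW x0)) expr2 -mulrA mulKf ?lt0r_neq0//.
  rewrite -[in leLHS](sqr_sqrtr (ltW x0)) lnXn// mulr_natl ler_wMn2r//.
  exact/ltW/ln_sublinear.
- exact: cvg_cst.
- rewrite -(mulr0 2); apply: cvgM; first exact: cvg_cst.
  apply/gtr0_cvgV0; last exact: cvg_sqrty.
  near=> x; rewrite sqrtr_gt0; near: x.
  by apply: nbhs_pinfty_gt; exact: num_real.
Unshelve. all: by end_near. Qed.

Lemma cvgMy_gt0 {R : realType} {I : Type} {F : set_system I} {FF : Filter F}
    (f g : I -> R) (l : R) :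
  f i @[i --> F] --> +oo -> g i @[i --> F] --> l -> 0 < l ->
  f i * g i @[i --> F] --> +oo.
Proof.
move=> fy gl l0; apply: (@ger_cvgy _ _ _ _ (fun i => f i * (l / 2))).
  near=> i; apply: ler_wpM2l; first by near: i; exact: cvgry_ge.
  by near: i; apply: (cvgr_ge _ gl); rewrite ltr_pdivrMr// ltr_pMr// ltr1n.
have l20 : 0 < l / 2 by rewrite divr_gt0.
exact: (cvg_comp _ _ fy (gt0_cvgMly l20 cvg_id)).
Unshelve. all: by end_near. Qed.

(** With L = ln n, the choice v = L + ln L / 2 + ln K makes
exp(-v) = 1 / (n K sqrt L), so that the product is sqrt (v / L), and v / L
tends to 1. *)
Lemma ex_norming_seq {R : realType} (K : R) : 0 < K ->
  exists v : nat -> R, [/\ forall n, 0 < v n, v n @[n --> \oo] --> +oo &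
    n%:R * (K * Num.sqrt (v n) * expR (- v n)) @[n --> \oo] --> (1 : R)].
Proof.
move=> K0.
pose L (n : nat) : R := ln n%:R.
have Ly : L n @[n --> \oo] --> +oo.
  exact: (cvg_comp _ _ cvgr_idn cvg_lny).
pose q n := 2^-1 * (ln (L n) / L n) + ln K / L n.
have q0 : q n @[n --> \oo] --> 0.
  rewrite -[0]addr0; apply: cvgD.
    rewrite -[X in _ --> X](mulr0 2^-1); apply: cvgM; first exact: cvg_cst.
    exact: (cvg_comp _ _ Ly cvg_ln_div).
  rewrite -[X in _ --> X](mulr0 (ln K)); apply: cvgM; first exact: cvg_cst.
  by apply/gtr0_cvgV0 => //; exact: cvgry_gt.
have q1 : 1 + q n @[n --> \oo] --> (1 : R).
  by rewrite -[X in _ --> X]addr0; apply: cvgD => //; exact: cvg_cst.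
pose w n := L n * (1 + q n).
have wy : w n @[n --> \oo] --> +oo by exact: (cvgMy_gt0 Ly q1 ltr01).
(* the maximum makes the first terms positive as well *)
pose v n := Num.max 1 (w n).
have vw : \forall n \near \oo, v n = w n.
  near=> n; apply/max_idPr; near: n; exact: cvgry_ge.
exists v; split.
- by move=> n; rewrite lt_max ltr01.
- by apply: cvg_trans wy; apply: near_eq_cvg; near=> n; apply/esym; near: n.
have : Num.sqrt (1 + q n) @[n --> \oo] --> (1 : R).
  rewrite -[X in _ --> X]sqrtr1.
  by apply: (cvg_comp _ Num.sqrt q1); exact: sqrt_continuous.
apply: cvg_trans; apply: near_eq_cvg; near=> n.
have -> : v n = w n by near: n.
have L0 : 0 < L n by near: n; exact: cvgry_gt.
have n0 : (0 : R) < n%:R by rewrite ltr0n; near: n; exact: nbhs_infty_gt.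
have s0 : 0 < Num.sqrt (L n) by rewrite sqrtr_gt0.
have wE : w n = ln (n%:R * K * Num.sqrt (L n)).
  rewrite !lnM ?posrE ?mulr_gt0// -powR12_sqrt ?ltW// ln_powR /w /q /L.
  by field; exact: lt0r_neq0.
rewrite {2}wE expRN lnK ?posrE ?mulr_gt0// /w sqrtrM ?ltW//.
by field; rewrite !lt0r_neq0.
Unshelve. all: by end_near. Qed.

(** This is c times the difference quotient of y^p at 1 with increment
c / v. *)
Lemma cvg_powR_slope {R : realType} {I : Type} {F : set_system I}
    {FF : Filter F} (v : I -> R) (c p : R) :
  v i @[i --> F] --> +oo ->
  v i * (1 + c / v i) `^ p - v i @[i --> F] --> c * p.
Proof.
move=> vy.
have [->|c0] := eqVneq c 0.
  (* the quotient is undefined at the null increment *)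
  rewrite mul0r; apply: cvg_near_cst; near=> i.
  by rewrite mul0r addr0 powR1 mulr1 subrr.
have u0 : c / v i @[i --> F] --> 0^'.
  have : c / v i @[i --> F] --> 0.
    rewrite -[X in _ --> X](mulr0 c); apply: cvgM; first exact: cvg_cst.
    by apply/gtr0_cvgV0 => //; exact: cvgry_gt.
  move=> cv A /cv /= Av.
  have {}Av : \forall i \near F, c / v i != 0 -> A (c / v i) := Av.
  have nz : \forall i \near F, c / v i != 0.
    near=> i.
    by rewrite mulf_neq0// invr_eq0 lt0r_neq0//; near: i; exact: cvgry_gt.
  by apply: filterS2 nz Av => i nz; apply.
have [dp dpE] := @is_derive1_powR R p 1 ltr01.
have slope : h^-1 *: (((powR (R:=R))^~ p \o shift 1) (h *: (1 : R)) - 1 `^ p)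
    @[h --> 0^'] --> p.
  rewrite [X in _ --> X](_ : _ = 'D_1 (@powR R ^~ p) 1); last first.
    by rewrite dpE powR1 mulr1.
  exact: dp.
have := @cvgMl_tmp _ _ _ FF _ c _ (cvg_comp _ _ u0 slope).
apply: cvg_trans; apply: near_eq_cvg; near=> i.
have vi0 : 0 < v i by near: i; exact: cvgry_gt.
rewrite /= /shift /= powR1 [_ *: 1]mulr1 [1 + _]addrC invf_div.
by rewrite /GRing.scale/=; field; rewrite ?c0 ?lt0r_neq0.
Unshelve. all: by end_near. Qed.

(** * The equivalent of the Maxwell tail *)

Definition maxwell_tail {R : realType} (sigma x : R) : R :=
  Num.sqrt (2 / pi) * (x / sigma) * expR (- (x ^+ 2 / (2 * sigma ^+ 2))).

(** The opposite of the derivative of [maxwell_tail]; for x > 0 it equals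
f(x) (1 - sigma^2/x^2), where f is the Maxwell density. *)
Definition maxwell_tail_rate {R : realType} (sigma x : R) : R :=
  Num.sqrt (2 / pi) * ((x ^+ 2 - sigma ^+ 2) / sigma ^+ 3)
  * expR (- (x ^+ 2 / (2 * sigma ^+ 2))).

(** The formula of the density without the case distinction on the sign of [x],
which makes its measurability immediate. *)
Definition maxwell_dens {R : realType} (sigma x : R) : R :=
  Num.sqrt (2 / pi) * (x ^+ 2 / sigma ^+ 3)
  * expR (- (x ^+ 2 / (2 * sigma ^+ 2))).

Lemma is_derive_maxwell_tail {R : realType} (sigma x : R) : 0 < sigma ->
  is_derive x 1 (fun y => - maxwell_tail sigma y) (maxwell_tail_rate sigma x).
Proof.
move=> s0.
pose a := (2 * sigma ^+ 2)^-1.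
pose k := Num.sqrt (2 / pi) / sigma.
have dg : is_derive x 1 ((- a) *: ((@id R) ^+ 2)) (- (x / sigma ^+ 2)).
  apply: is_derive_eq; rewrite /= !scaler1 /a /GRing.scale/=.
  by field; exact: lt0r_neq0.
have de := is_derive1_comp (is_derive_expR _) dg.
have dm := is_deriveM (is_deriveZ (- k) (is_derive_id x 1)) de.
have gE y : (- a *: @id R ^+ 2) y = - (y ^+ 2 / (2 * sigma ^+ 2)).
  change (- a * y ^+ 2 = - (y ^+ 2 / (2 * sigma ^+ 2))).
  by rewrite /a mulNr mulrC.
have -> : (fun y => - maxwell_tail sigma y) =
    (- k \*: @id R) * (expR \o (- a *: @id R ^+ 2)).
  apply/funext => y; rewrite /maxwell_tail -gE.
  change (- (Num.sqrt (2 / pi) * (y / sigma) * expR ((- a *: @id R ^+ 2) y)) =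
    (- k * y) * expR ((- a *: @id R ^+ 2) y)).
  by rewrite /k; field; exact: lt0r_neq0.
apply: is_derive_eq dm _.
rewrite /= gE /maxwell_tail_rate scaler1 /GRing.scale/= /k.
by field; exact: lt0r_neq0.
Qed.

Lemma continuous_maxwell_tail_rate {R : realType} (sigma : R) :
  continuous (maxwell_tail_rate sigma).
Proof.
move=> x; rewrite /maxwell_tail_rate; apply: cvgM; last first.
  apply: (cvg_comp _ expR); last exact: continuous_expR.
  apply: cvgN; apply: cvgM; last exact: cvg_cst.
  exact: exprn_continuous.
apply: cvgM; first exact: cvg_cst.
apply: cvgM; last exact: cvg_cst.
apply: cvgB; last exact: cvg_cst.
exact: exprn_continuous.
Qed.

Lemma measurable_maxwell_dens {R : realType} (sigma : R) D : measurable D ->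
  measurable_fun D (EFin \o maxwell_dens sigma).
Proof.
move=> mD; apply/measurable_EFinP; apply: measurable_funTS.
rewrite /maxwell_dens; apply: measurable_funM.
  by apply: measurable_funM => //; apply: measurable_funM.
apply: measurableT_comp => //; apply: measurableT_comp => //.
exact: measurable_funM.
Qed.

Lemma measurable_maxwell_tail_rate {R : realType} (sigma : R) D :
  measurable D ->
  measurable_fun D (EFin \o maxwell_tail_rate sigma).
Proof.
move=> mD; apply/measurable_EFinP; apply: measurable_funTS.
rewrite /maxwell_tail_rate; apply: measurable_funM.
  apply: measurable_funM => //; apply: measurable_funM => //.
  exact: measurable_funB.
apply: measurableT_comp => //; apply: measurableT_comp => //.
exact: measurable_funM.
Qed.

(** The bound exp y >= y at y = x^2/(2 sigma^2) bounds h by a multiple of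
1 / x. *)
Lemma cvg_maxwell_tail {R : realType} (sigma : R) : 0 < sigma ->
  maxwell_tail sigma x @[x --> +oo] --> 0.
Proof.
move=> s0.
apply: (@squeeze_cvgr _ _ _ _ (cst 0)
  (fun x => Num.sqrt (2 / pi) * (2 * sigma) * x^-1)).
- near=> x.
  have x0 : 0 < x by near: x; apply: nbhs_pinfty_gt; exact: num_real.
  apply/andP; split.
    rewrite /= /maxwell_tail mulr_ge0 ?expR_ge0// mulr_ge0 ?sqrtr_ge0//.
    by rewrite divr_ge0 ?ltW.
  rewrite /maxwell_tail /=.
  have y0 : 0 < x ^+ 2 / (2 * sigma ^+ 2).
    by rewrite divr_gt0 ?mulr_gt0 ?exprn_gt0.
  rewrite [leRHS](_ : _ = Num.sqrt (2 / pi) * (x / sigma)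
      * (x ^+ 2 / (2 * sigma ^+ 2))^-1); last first.
    by field; rewrite !lt0r_neq0 ?pi_gt0.
  rewrite ler_wpM2l//.
    by rewrite mulr_ge0 ?sqrtr_ge0// divr_ge0 ?ltW.
  rewrite expRN.
  rewrite lef_pV2 ?posrE ?expR_gt0// (le_trans _ (expR_ge1Dx _))//.
  by rewrite lerDr.
- exact: cvg_cst.
- rewrite -[X in _ --> X](mulr0 (Num.sqrt (2 / pi) * (2 * sigma))).
  apply: cvgM; first exact: cvg_cst.
  apply/gtr0_cvgV0; last exact: cvg_id.
  by near=> x; near: x; apply: nbhs_pinfty_gt; exact: num_real.
Unshelve. all: by end_near. Qed.

Lemma integral_maxwell_tail_rate {R : realType} (sigma z : R) :
  0 < sigma -> sigma <= z ->
  (\int[lebesgue_measure]_(x in `[z, +oo[) (maxwell_tail_rate sigma x)%:E =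
   (maxwell_tail sigma z)%:E)%E.
Proof.
move=> s0 sz.
rewrite (@ge0_continuous_FTC2y _ _ (fun x => - maxwell_tail sigma x) _ 0).
- by rewrite sub0e EFinN oppeK.
- (* among positive x, the integrand is nonnegative only from sigma on *)
  move=> x zx; rewrite /maxwell_tail_rate mulr_ge0 ?expR_ge0// mulr_ge0 ?sqrtr_ge0//.
  rewrite divr_ge0 ?exprn_ge0 ?(ltW s0)// subr_ge0 lerXn2r ?nnegrE ?(ltW s0)//.
    by rewrite (le_trans (ltW s0))// (le_trans sz).
  exact: le_trans zx.
- exact/continuous_subspaceT/continuous_maxwell_tail_rate.
- by rewrite -[X in _ --> X]oppr0; apply: cvgN; exact: cvg_maxwell_tail.
- by move=> x _; have [] := is_derive_maxwell_tail x s0.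
- apply: cvg_at_right_filter.
  have [/derivable1_diffP/differentiable_continuous + _] :=
    is_derive_maxwell_tail z s0.
  exact.
- by move=> x _; rewrite derive1E; have [_ ->] := is_derive_maxwell_tail x s0.
Qed.

Lemma maxwell_dens_ge0 {R : realType} (sigma x : R) : 0 < sigma ->
  0 <= maxwell_dens sigma x.
Proof.
move=> s0; rewrite /maxwell_dens mulr_ge0 ?expR_ge0// mulr_ge0 ?sqrtr_ge0//.
by rewrite divr_ge0 ?sqr_ge0 ?exprn_ge0 ?ltW.
Qed.

Lemma maxwell_tail_rate_bounds {R : realType} (sigma z x : R) :
  0 < sigma -> 0 < z -> z <= x ->
  (1 - sigma ^+ 2 / z ^+ 2) * maxwell_dens sigma x <= maxwell_tail_rate sigma x
    <= maxwell_dens sigma x.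
Proof.
move=> s0 z0 zx; have x0 : 0 < x by exact: lt_le_trans zx.
rewrite /maxwell_dens /maxwell_tail_rate; apply/andP; split.
  rewrite mulrA ler_pM2r ?expR_gt0// mulrCA ler_wpM2l ?sqrtr_ge0//.
  rewrite mulrA ler_pM2r ?invr_gt0 ?exprn_gt0// mulrBl mul1r lerD2l lerN2.
  rewrite -mulrA ler_peMr ?sqr_ge0// mulrC ler_pdivlMr ?exprn_gt0// mul1r.
  by rewrite lerXn2r ?nnegrE ?(ltW z0) ?(ltW x0).
rewrite ler_pM2r ?expR_gt0// ler_wpM2l ?sqrtr_ge0//.
by rewrite ler_pM2r ?invr_gt0 ?exprn_gt0// gerBl sqr_ge0.
Qed.

(** The pointwise bounds [maxwell_tail_rate_bounds] integrate to bounds on the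
tails. *)
Lemma maxwell_ccdf_bounds {R : realType} {d : measure_display}
    {T : measurableType d} (P : probability T R) (X : {RV P >-> R})
    (sigma z : R) :
  0 < sigma -> sigma < z -> has_maxwell_distribution X sigma ->
  (1 - sigma ^+ 2 / z ^+ 2) * fine (ccdf X z) <= maxwell_tail sigma z
    <= fine (ccdf X z).
Proof.
move=> s0 sz hX.
have z0 : 0 < z by exact: lt_trans sz.
have k0 : 0 <= 1 - sigma ^+ 2 / z ^+ 2.
  by rewrite subr_ge0 ler_pdivrMr ?exprn_gt0// mul1r lerXn2r ?nnegrE ?ltW.
have dens_ge0 x := maxwell_dens_ge0 x s0.
have rate_bnd x : z <= x -> _ := @maxwell_tail_rate_bounds R sigma z x s0 z0.
have SE : ccdf X z =
    (\int[lebesgue_measure]_(x in `[z, +oo[) (maxwell_dens sigma x)%:E)%E.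
  rewrite /ccdf hX// /maxwell_prob -integral_itv_obnd_cbnd; last first.
    exact: measurable_maxwell_dens.
  apply: eq_integral => x; rewrite inE/= in_itv/= andbT => zx.
  by rewrite /maxwell_pdf (lt_trans z0 zx).
have fS : ccdf X z \is a fin_num by rewrite fin_num_measure.
rewrite -!lee_fin EFinM !fineK// SE -(integral_maxwell_tail_rate s0 (ltW sz)).
have mN : measurable_fun `[z, +oo[ (EFin \o maxwell_tail_rate sigma).
  exact: measurable_maxwell_tail_rate.
have mD := measurable_itv `[z, +oo[.
apply/andP; split.
  rewrite -ge0_integralZl//; first last.
  - by move=> x _; rewrite lee_fin.
  - exact: measurable_maxwell_dens.
  apply: ge0_le_integral => //.
  - by move=> x _; rewrite -EFinM lee_fin mulr_ge0.
  - by apply: measurable_funeM; exact: measurable_maxwell_dens.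
  - move=> x; rewrite /= in_itv/= andbT => zx; rewrite -EFinM lee_fin.
    by have /andP[] := rate_bnd _ zx.
apply: ge0_le_integral => //.
- move=> x; rewrite /= in_itv/= andbT => zx; rewrite lee_fin.
  by have /andP[+ _] := rate_bnd _ zx; apply: le_trans; rewrite mulr_ge0.
- exact: measurable_maxwell_dens.
- move=> x; rewrite /= in_itv/= andbT => zx; rewrite lee_fin.
  by have /andP[] := rate_bnd _ zx.
Qed.

Lemma maxwell_tail_gt0 {R : realType} (sigma z : R) : 0 < sigma -> 0 < z ->
  0 < maxwell_tail sigma z.
Proof.
move=> s0 z0; rewrite !mulr_gt0 ?expR_gt0 ?invr_gt0//.
by rewrite sqrtr_gt0 divr_gt0 ?pi_gt0.
Qed.

Lemma cvg_maxwell_ccdf_div {R : realType} {d : measure_display}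
    {T : measurableType d} (P : probability T R) (X : {RV P >-> R})
    (sigma : R) :
  0 < sigma -> has_maxwell_distribution X sigma ->
  fine (ccdf X z) / maxwell_tail sigma z @[z --> +oo] --> (1 : R).
Proof.
move=> s0 hX.
apply: (@squeeze_cvgr _ _ _ _ (cst 1)
  (fun z => (1 - sigma ^+ 2 * (z ^+ 2)^-1)^-1)).
- near=> z.
  have sz : sigma < z by near: z; apply: nbhs_pinfty_gt; exact: num_real.
  have z0 := lt_trans s0 sz.
  have m0 := maxwell_tail_gt0 s0 z0.
  have k0 : 0 < 1 - sigma ^+ 2 / z ^+ 2.
    rewrite subr_gt0 ltr_pdivrMr ?exprn_gt0// mul1r.
    by rewrite ltrXn2r ?nnegrE ?(ltW s0) ?(ltW z0).
  have /andP[lo hi] := maxwell_ccdf_bounds s0 sz hX.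
  rewrite /= ler_pdivlMr// mul1r hi/= ler_pdivrMr//.
  by rewrite mulrC ler_pdivlMr// mulrC.
- exact: cvg_cst.
- rewrite -[X in _ --> X]invr1 -[X in _ --> X](congr1 GRing.inv (subr0 (1 : R))).
  apply: cvgV; first by rewrite subr0 oner_neq0.
  apply: cvgB; first exact: cvg_cst.
  rewrite -(mulr0 (sigma ^+ 2)); apply: cvgM; first exact: cvg_cst.
  apply/gtr0_cvgV0; last exact: cvgr_expr2.
  near=> z; rewrite exprn_gt0//; near: z; apply: nbhs_pinfty_gt; exact: num_real.
Unshelve. all: by end_near. Qed.

(** * Powers of a random variable *)

(** For z >= 1 and t > 0 the events X^t > z^t and X > z coincide as sets, negative
values of X included: at these the power takes the value 1, which does not
exceed z^t. *)
Lemma rcdf_RVpow {R : realType} {d : measure_display} {T : measurableType d}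
    (P : probability T R) (X : {RV P >-> R}) (t z : R) : 0 < t -> 1 <= z ->
  rcdf (RVpow X t : {RV P >-> R}) (z `^ t) = 1 - fine (ccdf X z).
Proof.
move=> t0 z1.
rewrite /rcdf cdf_1_ccdf fineB ?fin_num_measure//=.
congr (_ - fine _).
rewrite /ccdf /distribution/= /pushforward; congr (P _).
have z0 : 0 <= z by exact: le_trans z1.
apply/seteqP; split => w /=; rewrite !in_itv/= !andbT /RVpow => h.
- rewrite ltNge; apply/negP => Xz; move: h; apply/negP; rewrite -leNgt.
  have [X0|X0] := leP 0 (X w).
    by rewrite ge0_ler_powR// ?nnegrE ?(ltW t0).
  rewrite lt0_powR1// -[leLHS](powRr0 z); exact: ler_powR (ltW t0).
- by rewrite gt0_ltr_powR// nnegrE (le_trans z0)// ltW.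
Qed.

(** * Attraction to the Gumbel law *)

Theorem proposition2p1 (R : realType) (d : measure_display)
    (T : measurableType d) (P : probability T R) (sigma t : R)
    (X : {RV P >-> R}) :
  0 < sigma -> 0 < t -> t != 2 ->
  has_maxwell_distribution X sigma ->
  max_domain_of_attraction gumbel_cdf (rcdf (RVpow X t : {RV P >-> R})).
Proof.
move=> s0 t0 _ hX.
pose C : R := Num.sqrt (2 / pi).
have C0 : 0 < C by rewrite sqrtr_gt0 divr_gt0 ?pi_gt0.
have K0 : 0 < C * Num.sqrt 2 by rewrite mulr_gt0// sqrtr_gt0.
(* at b = sigma sqrt (2 v), h takes the value C sqrt 2 sqrt v exp(-v) *)
have [v [v0 vy nv1]] := ex_norming_seq K0.
pose b n := sigma * Num.sqrt (2 * v n).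
have b0 n : 0 < b n by rewrite mulr_gt0// sqrtr_gt0 mulr_gt0.
have b2 n : b n ^+ 2 / (2 * sigma ^+ 2) = v n.
  rewrite exprMn sqr_sqrtr ?mulr_ge0 ?ltW//; field; exact: lt0r_neq0.
have by_ : b n @[n --> \oo] --> +oo.
  have v2y : 2 * v n @[n --> \oo] --> +oo.
    rewrite (_ : (fun n => 2 * v n) = (fun n => v n * 2)).
      have h2 : cst (2 : R) n @[n --> \oo] --> (2 : R) by exact: cvg_cst.
      have := cvgMy_gt0 vy h2 (ltr0Sn R 1).
      exact.
    by apply/funext => n; rewrite mulrC.
  rewrite /b (_ : (fun n => _) = (fun n => Num.sqrt (2 * v n) * sigma)).
    exact: (cvgMy_gt0 (cvg_comp _ _ v2y cvg_sqrty) (cvg_cst sigma) s0).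
  by apply/funext => n; rewrite mulrC.
exists (fun n => b n `^ t * (t / (2 * v n))), (fun n => b n `^ t); split.
  by move=> n; rewrite mulr_gt0 ?powR_gt0// divr_gt0// mulr_gt0.
move=> x.
(* alpha_n x + beta_n = b_n^t r_n, so its t-th root is z_n = b_n q_n *)
pose r n := 1 + t * x / 2 / v n.
have r1 : r n @[n --> \oo] --> (1 : R).
  rewrite -[X in _ --> X]addr0; apply: cvgD; first exact: cvg_cst.
  rewrite -[X in _ --> X](mulr0 (t * x / 2)); apply: cvgM; first exact: cvg_cst.
  by apply/gtr0_cvgV0 => //; exact: cvgry_gt.
have r0 : \forall n \near \oo, 0 < r n by exact: (cvgr_gt _ r1).
pose q n := r n `^ t^-1.
have q1 : q n @[n --> \oo] --> (1 : R).
  rewrite -[X in _ --> X](congr1 (@^~ t^-1) (powR1 R)).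
  apply: (cvg_comp _ (fun y => y `^ t^-1) r1).
  have [/derivable1_diffP/differentiable_continuous + _] :=
    @is_derive1_powR R t^-1 1 ltr01.
  exact.
pose z n := b n * q n.
have zy : z n @[n --> \oo] --> +oo by exact: (cvgMy_gt0 by_ q1 ltr01).
pose S n := fine (ccdf X (z n)).
have zE : \forall n \near \oo,
    z n `^ t = b n `^ t * (t / (2 * v n)) * x + b n `^ t.
  near=> n.
  have rn0 : 0 < r n by near: n.
  rewrite powRM ?powR_ge0 ?ltW//.
  rewrite -powRrM mulVf ?lt0r_neq0// powRr1 ?ltW// /r; field.
  exact: lt0r_neq0.
have w2 n : z n ^+ 2 / (2 * sigma ^+ 2) = v n * r n `^ (2 / t).
  rewrite exprMn mulrAC b2 /q -powR_mulrn ?powR_ge0// -powRrM.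
  by rewrite [t^-1 * _]mulrC.
have nS : n%:R * S n @[n --> \oo] --> expR (- x).
  (* n S(z_n) is the product of S(z_n)/h(z_n), n h(b_n), z_n/b_n = q_n and
     exp(-(w_n - v_n)), where w_n = v_n r_n^(2/t) *)
  have -> : expR (- x) = 1 * (1 * 1 * expR (- x)) by rewrite !mul1r.
  have tail1 := cvg_comp _ _ zy (cvg_maxwell_ccdf_div s0 hX).
  have slope : v n * r n `^ (2 / t) - v n @[n --> \oo] --> x.
    have -> : x = t * x / 2 * (2 / t) by field; exact: lt0r_neq0.
    exact: cvg_powR_slope.
  have exp_slope : expR (- (v n * r n `^ (2 / t) - v n)) @[n --> \oo] --> expR (- x).
    apply: (cvg_comp _ expR); last exact: continuous_expR.
    exact: cvgN.
  have := cvgM tail1 (cvgM (cvgM nv1 q1) exp_slope) => /(_ _ _ _).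
  apply: cvg_trans; apply: near_eq_cvg; near=> n.
  have m0 : 0 < maxwell_tail sigma (z n).
    by apply: maxwell_tail_gt0 => //; near: n; exact: cvgry_gt.
  rewrite /= opprB expRD.
  have e0 : expR (- v n) != 0 by rewrite lt0r_neq0 ?expR_gt0.
  have -> : n%:R * S n =
      S n / maxwell_tail sigma (z n) * (n%:R * maxwell_tail sigma (z n)).
    by field; exact: lt0r_neq0.
  congr (_ * _).
  rewrite /maxwell_tail w2 -/C /z /b sqrtrM//.
  have -> : expR (v n) = (expR (- v n))^-1 by rewrite expRN invrK.
  by field; rewrite e0 lt0r_neq0.
apply: cvg_trans (cvg_onemXn_expR nS); apply: near_eq_cvg; near=> n.
have <- : z n `^ t = b n `^ t * (t / (2 * v n)) * x + b n `^ t by near: n.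
have zn1 : 1 <= z n by near: n; exact: cvgry_ge.
by congr (_ ^+ n); exact: esym (rcdf_RVpow X t0 zn1).
Unshelve. all: by end_near. Qed.
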